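(* Let $a$ and $b$ be odd nonzero coprime integers, let $k,T$ be integers with $0\le T<k$, and let $d_0$ be an odd positive integer. Then the following statements hold. (1) $2d_0\in G_{(T,k)}(a,b)$ if and only if $d_0\in G_{(T,k)}(a,b)$. (2) For every integer $\varepsilon\ge 2$, $2^\varepsilon d_0\in G_{(T,k)}(a,b)$ if and only if $\varepsilon\le \nu_2(a+b)$ and there exists a positive integer $s$ such that $d_0\mid (a^{ks+T}+b^{ks+T})$ and $ks+T$ is odd.
   Context: For nonzero coprime integers $a,b$ and integers $0\le T<k$, $G_{(T,k)}(a,b)$ denotes the set of positive integers $d$ such that $d\mid (a^{ks+T}+b^{ks+T})$ for some positive integer $s$. $\nu_2(i)$ is the $2$-adic valuation of a nonzero integer $i$, with the convention $\nu_2(0)=+\infty$. *)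

(* Defs.v *)
From mathcomp Require Import all_boot all_order all_algebra.
From mathcomp Require Import classical_sets constructive_ereal.

Set Implicit Arguments.
Unset Strict Implicit.
Unset Printing Implicit Defensive.

Import Order.TTheory GRing.Theory Num.Theory.

Local Open Scope ring_scope.
Local Open Scope classical_set_scope.

Definition G (T k : nat) (a b : int) : set nat :=
  [set d | (0 < d)%N /\
     exists s : nat, (0 < s)%N /\
       (d %| a ^+ (k * s + T) + b ^+ (k * s + T))%Z].

(* The value at 0 is +oo, unlike [logn 2 0 = 0]. *)
Definition nu2 (i : int) : \bar int :=
  if i == 0 then +oo%E else ((logn 2 `|i|%N)%:Z)%:E.

(* Main.v *)
Require Import Defs.
From mathcomp Require Import all_boot all_order all_algebra.
From mathcomp Require Import classical_sets constructive_ereal.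
From mathcomp Require Import zify.

(** Write [n] for an exponent [k * s + T].  Since [d0] is odd,
    [2 ^ e * d0] divides [a ^+ n + b ^+ n] if and only if [2 ^ e] and [d0] both
    do, so only the 2-part of [a ^+ n + b ^+ n] matters.  This sum of two odd
    integers is always even, which is the case [e = 1].
    For [2 <= e] the parity of [n] decides.  If [n] is even, both powers are odd
    squares, so their sum is 2 modulo 4 and [2 ^ e] cannot divide it
    ([not_dvdz4_addXX]).  If [n] is odd, then [a + b] divides [a ^+ n + b ^+ n]
    and the cofactor is a sum of [n] odd terms, hence odd, so that the two
    numbers have the same 2-part ([dvdz_pow2_addXX]). *)

Set Implicit Arguments.
Unset Strict Implicit.
Unset Printing Implicit Defensive.

Import Order.TTheory GRing.Theory Num.Theory.

Local Open Scope ring_scope.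

Lemma dvdz2_subr1 (x : int) : ~~ (2 %| x)%Z -> (2 %| x - 1)%Z.
Proof. lia. Qed.

Lemma not_dvdz2M (x y : int) :
  ~~ (2 %| x)%Z -> ~~ (2 %| y)%Z -> ~~ (2 %| x * y)%Z.
Proof.
move=> x_odd y_odd; rewrite dvdzE abszM Euclid_dvdM // negb_or.
by apply/andP.
Qed.

Lemma not_dvdz2X (x : int) (n : nat) : ~~ (2 %| x)%Z -> ~~ (2 %| x ^+ n)%Z.
Proof.
by move=> x_odd; elim: n => [//|n IHn]; rewrite exprS; apply: not_dvdz2M.
Qed.

(** Each term is 1 modulo 2, so the sum is congruent to the odd number [n]. *)
Lemma not_dvdz2_sum (n : nat) (F : 'I_n -> int) :
  odd n -> (forall i, ~~ (2 %| F i)%Z) -> ~~ (2 %| \sum_(i < n) F i)%Z.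
Proof.
move=> n_odd F_odd.
have : (2 %| \sum_(i < n) (F i - 1))%Z.
  by apply: rpred_sum => i _; apply: dvdz2_subr1.
by rewrite sumrB sumr_const card_ord natz; move: (\sum_(i < n) F i) => S; lia.
Qed.

Lemma dvdz4_sqr_subr1 (x : int) : ~~ (2 %| x)%Z -> (4 %| x ^+ 2 - 1)%Z.
Proof.
move=> x_odd; rewrite subr_sqr_1.
by apply: (@dvdz_mul 2 2); lia.
Qed.

(** For even [n] both powers are squares of odd integers, hence 1 modulo 4. *)
Lemma not_dvdz4_addXX (a b : int) (n : nat) :
  ~~ (2 %| a)%Z -> ~~ (2 %| b)%Z -> ~~ odd n -> ~~ (4 %| a ^+ n + b ^+ n)%Z.
Proof.
move=> a_odd b_odd n_even; rewrite -(even_halfK n_even) -muln2 !exprM.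
have := dvdz4_sqr_subr1 (not_dvdz2X n./2 a_odd).
have := dvdz4_sqr_subr1 (not_dvdz2X n./2 b_odd).
move: ((a ^+ n./2) ^+ 2) ((b ^+ n./2) ^+ 2) => x y; lia.
Qed.

(** For odd [n], [a ^+ n + b ^+ n = a ^+ n - (- b) ^+ n] factors as [a + b]
    times a sum of [n] odd terms. *)
Lemma dvdz_pow2_addXX (a b : int) (n e : nat) :
  ~~ (2 %| a)%Z -> ~~ (2 %| b)%Z -> odd n ->
  ((2 ^ e)%N %| a ^+ n + b ^+ n)%Z = ((2 ^ e)%N %| a + b)%Z.
Proof.
move=> a_odd b_odd n_odd.
have -> : a ^+ n + b ^+ n = a ^+ n - (- b) ^+ n.
  by rewrite exprNn -signr_odd n_odd expr1 mulN1r opprK.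
rewrite subrXX opprK Gauss_dvdzl // coprimezE.
apply: coprimeXl; rewrite prime_coprime //.
apply: not_dvdz2_sum => // i; apply: not_dvdz2M; apply: not_dvdz2X => //.
by rewrite dvdzE abszN.
Qed.

(** At [x = 0] both sides hold for every [e], which is the reason for the value
    [+oo] of [nu2] there; this case occurs when [b = - a]. *)
Lemma le_nu2E (e : nat) (x : int) : (e%:Z%:E <= nu2 x)%E = ((2 ^ e)%N %| x)%Z.
Proof.
rewrite /nu2; case: eqVneq => [->|x_neq0]; first by rewrite leey dvdz0.
by rewrite lee_fin lez_nat dvdzE pfactor_dvdn // absz_gt0.
Qed.

Lemma dvdz_pow2M_odd (e d : nat) (x : int) : odd d ->
  ((2 ^ e * d)%N %| x)%Z = ((2 ^ e)%N %| x)%Z && (d %| x)%Z.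
Proof.
by move=> d_odd; rewrite !dvdzE Gauss_dvd // coprimeXl // coprime2n.
Qed.

Theorem proposition11 (a b : int) (a_neq0 : a != 0) (b_neq0 : b != 0)
    (a_odd : ~~ (2 %| a)%Z) (b_odd : ~~ (2 %| b)%Z) (ab_coprime : coprimez a b)
    (k T : nat) (ltTk : (T < k)%N)
    (d0 : nat) (d0_gt0 : (0 < d0)%N) (d0_odd : odd d0) :
  (G T k a b (2 * d0)%N <-> G T k a b d0) /\
  (forall e : nat, (2 <= e)%N ->
     (G T k a b (2 ^ e * d0)%N <->
      ((e%:Z)%:E <= nu2 (a + b))%E /\
      exists s : nat, [/\ (0 < s)%N,
        (d0 %| a ^+ (k * s + T) + b ^+ (k * s + T))%Z &
        odd (k * s + T)])).
Proof.
split=> [|e le2e].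
  have sum_even n : (2 %| a ^+ n + b ^+ n)%Z.
    by have := not_dvdz2X n a_odd; have := not_dvdz2X n b_odd; lia.
  split=> -[_ [s [s_gt0 dvd_s]]]; split; rewrite ?muln_gt0 //; exists s; split=> //.
    by move: dvd_s; rewrite (dvdz_pow2M_odd 1) // => /andP[].
  by rewrite (dvdz_pow2M_odd 1) // dvd_s sum_even.
rewrite le_nu2E; split=> [[_ [s [s_gt0]]]|[dvd_ab [s [s_gt0 dvd_s n_odd]]]].
  rewrite dvdz_pow2M_odd // => /andP[dvd_e dvd_s].
  have n_odd : odd (k * s + T).
    (* since [2 <= e], 4 divides the sum of powers *)
    apply: contraT => /(not_dvdz4_addXX a_odd b_odd) /negP[].
    by apply: dvdz_trans dvd_e; rewrite dvdzE (dvdn_exp2l 2 le2e).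
  split; last by exists s.
  by rewrite -(dvdz_pow2_addXX e a_odd b_odd n_odd).
split; first by rewrite muln_gt0 expn_gt0.
exists s; split=> //.
by rewrite dvdz_pow2M_odd // dvdz_pow2_addXX // dvd_ab dvd_s.
Qed.
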